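(* Let $n$ be a positive integer, let $F(x)=x^{2^n-2}$ be a power function over $\mathbb{F}_{2^n}$, and let $c\in\mathbb{F}_{2^n}$ with $c\neq 0,1$. (1) If $\mathrm{Tr}_n(c)=\mathrm{Tr}_n(\frac1c)=1$, then $F$ is AP$c$N with $c$-differential spectrum $$\mathbb S=\{{}_c\omega_0=2^{n-1}-2,\ {}_c\omega_1=4,\ {}_c\omega_2=2^{n-1}-2\}.$$ (2) If $\mathrm{Tr}_n(c)=1,\ \mathrm{Tr}_n(\frac1c)=0$, or $\mathrm{Tr}_n(c)=0,\ \mathrm{Tr}_n(\frac1c)=1$, then $F$ is differentially $(c,3)$-uniform with $c$-differential spectrum $$\mathbb S=\{{}_c\omega_0=2^{n-1}-1,\ {}_c\omega_1=3,\ {}_c\omega_2=2^{n-1}-3,\ {}_c\omega_3=1\}.$$ (3) If $\mathrm{Tr}_n(c)=\mathrm{Tr}_n(\frac1c)=0$, then $F$ is differentially $(c,3)$-uniform with $c$-differential spectrum $$\mathbb S=\{{}_c\omega_0=2^{n-1},\ {}_c\omega_1=2,\ {}_c\omega_2=2^{n-1}-4,\ {}_c\omega_3=2\}.$$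
   Context: $\mathrm{Tr}_n$ denotes the absolute trace from $\mathbb{F}_{2^n}$ to $\mathbb{F}_2$. For a function $F:\mathbb{F}_q\to\mathbb{F}_q$ and $a,b,c\in\mathbb{F}_q$, define ${}_c\delta_F(a,b)=\#\{x\in\mathbb{F}_q : F(x+a)-cF(x)=b\}$. The $c$-differential uniformity is ${}_c\Delta_F=\max\{{}_c\delta_F(a,b) : a,b\in\mathbb{F}_q,\ \text{and } a\neq 0 \text{ if } c=1\}$. $F$ is differentially $(c,\delta)$-uniform if ${}_c\Delta_F=\delta$, and AP$c$N (almost perfect $c$-nonlinear) if ${}_c\Delta_F=2$. For a power function $F(x)=x^d$ put ${}_c\omega_i=\#\{b\in\mathbb{F}_q : {}_c\delta_F(1,b)=i\}$ for $0\le i\le {}_c\Delta_F$; the $c$-differential spectrum of $F$ is the multiset $\mathbb S=\{{}_c\omega_i : 0\le i\le {}_c\Delta_F \text{ and } {}_c\omega_i>0\}$, written by listing the values of the ${}_c\omega_i$.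
   Formalization: In (1), the claim that F is APcN is stated only for n ≠ 2: over F_4, F(x)=x² and F(x+a)−cF(x)=(1−c)x²+a² is a bijection, so the c-differential uniformity is 1, not 2. The spectrum in (1) is still stated for n = 2, with zero values dropped. *)

(* Defs.v *)
From mathcomp Require Import all_boot all_algebra.

Set Implicit Arguments.
Unset Strict Implicit.
Unset Printing Implicit Defensive.

Import GRing.Theory.
Local Open Scope ring_scope.

(* When #|K| = 2 ^ n this is the absolute trace Tr_n of K over its prime field
   F_2; its values 0 and 1 are taken in the prime subfield of K. *)
Definition abs_trace (K : finFieldType) (n : nat) (x : K) : K :=
  \sum_(i < n) x ^+ (2 ^ i)%N.

Definition power_fun (K : finFieldType) (d : nat) : K -> K := fun x => x ^+ d.

Definition cdelta (K : finFieldType) (F : K -> K) (c a b : K) : nat :=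
  #|[set x : K | F (x + a) - c * F x == b]|.

Definition cuniformity (K : finFieldType) (F : K -> K) (c : K) : nat :=
  (\max_(a : K | (c == 1%R) ==> (a != 0%R)) \max_(b : K) cdelta F c a b)%N.

Definition differentially_uniform (K : finFieldType) (F : K -> K) (c : K)
    (delta : nat) : Prop :=
  cuniformity F c = delta.

Definition APcN (K : finFieldType) (F : K -> K) (c : K) : Prop :=
  cuniformity F c = 2%N.

(* Restricting to the shift a = 1 is meant for power functions F. *)
Definition comega (K : finFieldType) (F : K -> K) (c : K) (i : nat) : nat :=
  #|[set b : K | cdelta F c 1 b == i]|.

(* A multiset of naturals, represented by a list up to perm_eq. *)
Definition cspectrum (K : finFieldType) (F : K -> K) (c : K) : seq nat :=
  [seq w <- [seq comega F c i | i <- iota 0 (cuniformity F c).+1] | (0 < w)%N].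

(* "The spectrum is {omega_0 = s_0, ..., omega_k = s_k}": the labelled values
   omega_i = s_i hold, and the spectrum is the multiset of the s_i, a listed
   value 0 not being counted. *)
Definition has_cspectrum (K : finFieldType) (F : K -> K) (c : K)
    (s : seq nat) : Prop :=
  (forall i, (i < size s)%N -> comega F c i = nth 0%N s i) /\
  perm_eq (cspectrum F c) [seq w <- s | (0 < w)%N].

(* Main.v *)
(** Over a field of characteristic 2, inverting turns F(x+1) - cF(x) = b, away
    from x = 0 and x = 1, into the quadratic b x^2 + (b+1+c) x + c = 0, which
    vanishes at neither 0 nor 1; x = 0 is an extra solution exactly when b = 1
    and x = 1 exactly when b = c.  By Artin-Schreier a quadratic
    a x^2 + b x + g with a, b nonzero has two roots if Tr(a g / b^2) = 0 and
    none otherwise, so every c-differential count is even except at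
    b = 0, 1, c, 1+c, where it is respectively 1, 1 + 2[Tr(1/c) = 0],
    1 + 2[Tr(c) = 0] and 1.  This gives omega_1 and omega_3; omega_0 and omega_2
    then follow from sum_i omega_i = sum_i i omega_i = 2^n. *)
Require Import Defs.
From mathcomp Require Import all_boot all_algebra.
From mathcomp Require Import finfield zify ring.

Import GRing.Theory.
Local Open Scope ring_scope.

(** * Counting solutions over an arbitrary finite field *)

Lemma comega_sum (K : finFieldType) (F : K -> K) (c : K) (i : nat) :
  comega F c i = (\sum_(b : K) (cdelta F c 1%R b == i))%N.
Proof.
by rewrite /comega -sum1_card big_mkcond /=; apply: eq_bigr => b _; rewrite inE; case: eqP.
Qed.

Lemma cdelta_sum (K : finFieldType) (F : K -> K) (c a : K) :
  (\sum_(b : K) cdelta F c a b)%N = #|K|.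
Proof.
rewrite -sum1_card [RHS](partition_big (fun x => F (x + a) - c * F x) xpredT) //=.
by apply: eq_bigr => b _; rewrite /cdelta -sum1_card; apply: eq_bigl => x; rewrite inE.
Qed.

Lemma cdelta_le_cuniformity (K : finFieldType) (F : K -> K) (c a b : K) :
  (c == 1) ==> (a != 0) -> (cdelta F c a b <= cuniformity F c)%N.
Proof.
move=> ha; apply: (bigmax_sup a) => //.
exact: (bigmax_sup b).
Qed.

(** Indices beyond the uniformity contribute only zeros, which the spectrum discards, so a list
    longer than needed is harmless. *)
Lemma has_cspectrumP (K : finFieldType) (F : K -> K) (c : K) (s : seq nat) :
  (cuniformity F c < size s)%N ->
  (forall i, (i < size s)%N -> comega F c i = nth 0%N s i) ->
  has_cspectrum F c s.
Proof.
move=> us hs; split=> //.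
have -> : s = [seq comega F c i | i <- iota 0 (size s)].
  apply: (@eq_from_nth _ 0%N) => [|i hi]; first by rewrite size_map size_iota.
  by rewrite (nth_map 0%N) ?size_iota // nth_iota // hs.
rewrite /cspectrum -(subnKC us) iotaD map_cat filter_cat.
rewrite [X in _ ++ X](_ : _ = [::]) ?cats0 //.
apply/eqP; rewrite -size_eq0 size_filter -leqn0 leqNgt -has_count; apply/hasPn => w.
case/mapP=> i; rewrite mem_iota => /andP[hi _] ->.
rewrite -eqn0Ngt cards_eq0; apply/eqP/setP => b; rewrite !inE.
have := @cdelta_le_cuniformity K F c 1 b; rewrite oner_neq0 implybT => /(_ isT) h.
by apply/eqP => e; move: hi; rewrite -e add0n ltnNge h.
Qed.

(** * Trace, Artin-Schreier equations and quadratics in characteristic 2 *)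

Section BinaryField.

Variables (n : nat) (K : finFieldType).
Hypotheses (n_gt0 : (0 < n)%N) (cardK : #|K| = (2 ^ n)%N).

Let char2 : 2%N \in [pchar K].
Proof. exact: card_finPcharP cardK isT. Qed.

Let addxx (x : K) : x + x = 0. Proof. exact: addrr_pchar2 char2 _. Qed.

Lemma binary_addr_eq0 (x y : K) : (x + y == 0) = (x == y).
Proof. by rewrite -[RHS]subr_eq0 (oppr_pchar2 char2). Qed.

Lemma binary_sqrrD (x y : K) : (x + y) ^+ 2 = x ^+ 2 + y ^+ 2.
Proof. by rewrite sqrrD mulr2n addxx addr0. Qed.

Lemma abs_trace_sqr (x : K) : abs_trace n (x ^+ 2) = abs_trace n x ^+ 2.
Proof.
rewrite /abs_trace; elim: n => [|m IH]; first by rewrite !big_ord0 expr0n.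
by rewrite !big_ord_recr /= binary_sqrrD IH -!exprM mulnC.
Qed.

Lemma abs_traceD_sqr (x : K) : abs_trace n (x ^+ 2 + x) = 0.
Proof.
(* The conjugates telescope; at [m = n] the right side is [x + x]. *)
suff tel m : \sum_(i < m) (x ^+ 2 + x) ^+ (2 ^ i) = x ^+ (2 ^ m) + x.
  by rewrite /abs_trace tel -cardK expf_card addxx.
elim: m => [|m IH]; first by rewrite big_ord0 expr1 addxx.
rewrite big_ord_recr /= IH exprDn_pchar; last first.
  by rewrite (eq_pnat _ (pcharf_eq char2)) pnatX pnat_id.
by rewrite -exprM -expnS [X in _ + X]addrC addrACA addxx add0r addrC.
Qed.

(** The trace is a polynomial of degree [2 ^ n.-1], which bounds its number of roots. *)
Lemma card_abs_trace_ker : (#|[set u : K | abs_trace n u == 0%R]| <= 2 ^ n.-1)%N.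
Proof.
pose p : {poly K} := \sum_(i < n) 'X^(2 ^ i).
have sp : size p = (2 ^ n.-1).+1.
  rewrite /p; case: n n_gt0 => // m _; rewrite big_ord_recr /= addrC size_polyDl size_polyXn //.
  rewrite ltnS; apply: leq_trans (size_sum _ _ _) _; apply/bigmax_leqP => i _.
  by rewrite size_polyXn ltn_exp2l.
have p0 : p != 0 by rewrite -size_poly_gt0 sp.
rewrite cardE -ltnS -sp; apply: max_poly_roots => //; last exact: enum_uniq.
apply/allP => u; rewrite mem_enum inE /root /p horner_sum => /eqP e; rewrite -[X in _ == X]e.
by apply/eqP; apply: eq_bigr => i _; rewrite hornerXn.
Qed.

Lemma artin_schreier_fiber (y : K) :
  [set x | x ^+ 2 + x == y ^+ 2 + y] = [set y; y + 1].
Proof.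
apply/setP => x; rewrite !inE -binary_addr_eq0.
have -> : x ^+ 2 + x + (y ^+ 2 + y) = (x + y) * (x + (y + 1)).
  have -> : (x + y) * (x + (y + 1)) = (x + y) ^+ 2 + (x + y) by ring.
  by rewrite binary_sqrrD; ring.
by rewrite mulf_eq0 !binary_addr_eq0.
Qed.

Let card_fiber (y : K) : #|[set x | x ^+ 2 + x == y ^+ 2 + y]| = 2%N.
Proof.
rewrite artin_schreier_fiber cards2 eq_sym -binary_addr_eq0.
by rewrite addrAC addxx add0r oner_neq0.
Qed.

(** One inclusion is the telescoping identity. Equality follows by counting: all fibres of
    [y ^+ 2 + y] have two elements, so the image is at least as large as the kernel of the trace. *)
Lemma artin_schreier_image :
  [set y ^+ 2 + y | y : K] = [set u : K | abs_trace n u == 0].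
Proof.
apply/eqP; rewrite eqEcard; apply/andP; split.
  by apply/subsetP => _ /imsetP[y _ ->]; rewrite inE abs_traceD_sqr.
apply: leq_trans card_abs_trace_ker _; rewrite -(leq_pmul2r (m := 2)) // -expnSr prednK //.
rewrite -cardK -sum_nat_const -sum1_card (partition_big_imset (fun y : K => y ^+ 2 + y)) /=.
apply: leq_sum => _ /imsetP[y _ ->]; rewrite -[leqRHS](card_fiber y) -sum1_card.
by apply/eq_leq/eq_bigl => x; rewrite inE.
Qed.

Lemma card_artin_schreier (u : K) :
  #|[set y | y ^+ 2 + y == u]| = ((abs_trace n u == 0%R) * 2)%N.
Proof.
have := in_set (fun u => abs_trace n u == 0) u; rewrite -artin_schreier_image => <-.
case: imsetP => [[y _ ->]|nex]; first by rewrite card_fiber.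
apply/eqP; rewrite cards_eq0; apply/eqP/setP => y; rewrite !inE.
by apply/eqP => e; apply: nex; exists y.
Qed.

(** The substitution [x = b / a * y] reduces to [y ^+ 2 + y = a * g / b ^+ 2]. *)
Lemma card_quadratic (a b g : K) : a != 0 -> b != 0 ->
  #|[set x | a * x ^+ 2 + b * x + g == 0]| = ((abs_trace n (a * g / b ^+ 2) == 0%R) * 2)%N.
Proof.
move=> a0 b0; rewrite -card_artin_schreier.
have ba0 : b / a != 0 by rewrite mulf_neq0 ?invr_eq0.
rewrite -[RHS](card_imset _ (mulfI ba0)); apply: eq_card => x.
rewrite -[x](mulVKf ba0) mem_imset; last exact: mulfI.
rewrite !inE; set y := _^-1 * x.
have -> : a * (b / a * y) ^+ 2 + b * (b / a * y) + g
   = b ^+ 2 / a * ((y ^+ 2 + y) + a * g / b ^+ 2) by field; rewrite a0 b0.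
by rewrite mulf_eq0 binary_addr_eq0 (negPf (mulf_neq0 _ _)) ?invr_eq0 ?expf_neq0.
Qed.

(** * The inverse function and its exceptional values *)

Section Inversion.

Variable c : K.
Hypotheses (c0 : c != 0) (c1 : c != 1).

Let F : K -> K := power_fun (2 ^ n - 2).

Let n_gt1 : (1 < n)%N.
Proof.
have : (2 < #|K|)%N.
  have <- : #|[set c; 0; 1]| = 3%N.
    by rewrite -setUA cardsU1 cards2 !inE negb_or c0 c1 eq_sym oner_neq0.
  exact: max_card.
by rewrite cardK -[X in (X < _)%N]expn1 ltn_exp2l.
Qed.

Let c1_neq0 : 1 + c != 0.
Proof. by rewrite binary_addr_eq0 eq_sym. Qed.

Let c1_neq1 : 1 + c != 1.
Proof. by rewrite -binary_addr_eq0 addrAC addxx add0r. Qed.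

Let c1_neqc : 1 + c != c.
Proof. by rewrite -binary_addr_eq0 -addrA addxx addr0 oner_neq0. Qed.

Lemma power_funV (x : K) : F x = x^-1.
Proof.
have e : (2 ^ n = (2 ^ n - 2).+2)%N.
  have : (2 ^ 1 <= 2 ^ n)%N by rewrite leq_exp2l // ltnW.
  by lia.
rewrite /F /power_fun; have [->|x0] := eqVneq x 0.
  (* Agreement with the convention [0^-1 = 0] requires a positive exponent, hence [n >= 2]. *)
  rewrite invr0 expr0n; have : (2 ^ 2 <= 2 ^ n)%N by rewrite leq_exp2l.
  by rewrite e; case: (_ - _)%N.
apply: (mulfI x0); apply: (mulfI x0); rewrite -!exprS -e -cardK expf_card.
by rewrite mulfV ?mulr1.
Qed.

(** Since [F (a * y) = a^-1 * F y], putting [x = a * y] normalises the shift. *)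
Lemma cdelta_scale (a b : K) : a != 0 -> cdelta F c a b = cdelta F c 1 (a * b).
Proof.
move=> a0; rewrite /cdelta -[RHS](card_imset _ (mulfI a0)); apply: eq_card => x.
rewrite -[x](mulVKf a0) mem_imset; last exact: mulfI.
rewrite !inE !power_funV; set y := _^-1 * x.
rewrite -{2}[a]mulr1 -mulrDr !invfM mulrCA -mulrBr.
by rewrite -(inj_eq (mulfI a0)) mulrA mulfV // mul1r.
Qed.

(** The equation is [(1 + c) / x = b], and inversion extended by [0^-1 = 0] is bijective. *)
Lemma cdelta_shift0 (b : K) : cdelta F c 0 b = 1%N.
Proof.
rewrite /cdelta -[RHS](cards1 (b / (1 + c))^-1); apply: eq_card => x.
rewrite !inE !power_funV addr0 (oppr_pchar2 char2) -[in LHS](mul1r x^-1) mulrA mulr1 -mulrDl.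
by rewrite -[RHS](inj_eq invr_inj) invrK -[RHS](inj_eq (mulfI c1_neq0)) [in RHS]mulrCA mulfV ?mulr1.
Qed.

Lemma cdelta_quadratic (b : K) : cdelta F c 1 b =
  (#|[set x : K | (b * x ^+ 2 + (b + 1 + c) * x + c == 0)%R]| + (b == 1%R) + (b == c))%N.
Proof.
rewrite /cdelta (cardsD1 0) (cardsD1 1) !inE oner_neq0 !power_funV addxx add0r.
rewrite invr1 invr0 !mulr0 !mulr1 subr0 add0r (oppr_pchar2 char2) addnA addnC.
rewrite (eq_sym 1) (eq_sym c) addnA; congr (_ + _ + _)%N; apply: eq_card => x.
rewrite !inE !power_funV (oppr_pchar2 char2).
(* The points 0 and 1 were split off; the quadratic takes the nonzero values [c] and 1 there. *)
have [->|x0] := eqVneq x 0; first by rewrite expr0n !mulr0 !add0r (negPf c0) andbF.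
have [->|x1] := eqVneq x 1.
  by rewrite /= expr1n !mulr1 !addrA addxx add0r addrAC -addrA addxx addr0 oner_eq0.
have x10 : x + 1 != 0 by rewrite binary_addr_eq0.
rewrite /= -binary_addr_eq0.
have -> : (x + 1)^-1 + c / x + b
    = (b * x ^+ 2 + (b + 1 + c) * x + c) / (x * (x + 1)) by field; rewrite x10.
by rewrite mulf_eq0 invr_eq0 (negPf (mulf_neq0 _ _)) ?orbF.
Qed.

Lemma cdelta_at0 : cdelta F c 1 0 = 1%N.
Proof.
rewrite cdelta_quadratic ![0 == _]eq_sym oner_eq0 (negPf c0) !addn0.
(* For [b = 0] the equation is linear. *)
rewrite -[RHS](cards1 (c / (1 + c))); apply: eq_card => x.
rewrite !inE mul0r !add0r binary_addr_eq0.
by rewrite -[RHS](inj_eq (mulfI c1_neq0)) [in RHS]mulrCA mulfV ?mulr1.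
Qed.

Lemma cdelta_at1c : cdelta F c 1 (1 + c) = 1%N.
Proof.
rewrite cdelta_quadratic (negPf c1_neq1) (negPf c1_neqc) !addn0.
(* The linear term vanishes, and the [2 ^ n.-1]-th power is the square root, the inverse of
   Frobenius. *)
rewrite -[RHS](cards1 ((c / (1 + c)) ^+ (2 ^ n.-1))); apply: eq_card => x.
rewrite !inE -(addrA _ 1 c) addxx mul0r addr0.
rewrite -[RHS]binary_addr_eq0 -[RHS]sqrf_eq0 [in RHS]binary_sqrrD -exprM -expnSr prednK // -cardK expf_card.
by rewrite !binary_addr_eq0 -[RHS](inj_eq (mulfI c1_neq0)) [(1 + c) * (c / _)]mulrCA mulfV ?mulr1.
Qed.

Lemma cdelta_at1 : cdelta F c 1 1 = (1 + (abs_trace n (1 / c) == 0%R) * 2)%N.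
Proof.
rewrite cdelta_quadratic eqxx [1 == c]eq_sym (negPf c1) addn0 addnC addxx add0r.
(* The quadratic is [x ^+ 2 + c * x + c], with invariant [c / c ^+ 2]. *)
rewrite card_quadratic ?oner_neq0 //; congr (_ + (abs_trace n _ == _) * _)%N.
by field.
Qed.

Lemma cdelta_atc : cdelta F c 1 c = (1 + (abs_trace n c == 0%R) * 2)%N.
Proof.
rewrite cdelta_quadratic eqxx (negPf c1) addn0 addnC addrAC addxx add0r.
(* The quadratic is [c * x ^+ 2 + x + c], with invariant [c ^+ 2], whose trace is the square of that
   of [c]. *)
rewrite card_quadratic ?oner_neq0 // expr1n divr1 -expr2 abs_trace_sqr.
by rewrite sqrf_eq0.
Qed.

Lemma cdelta_generic (b : K) : b \notin [:: 0; 1 + c; 1; c] ->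
  cdelta F c 1 b = 0%N \/ cdelta F c 1 b = 2%N.
Proof.
rewrite !inE !negb_or => /and4P[b0 b1c b1 bc].
rewrite cdelta_quadratic (negPf b1) (negPf bc) !addn0 card_quadratic //.
  by case: (_ == _); [right|left].
by rewrite -addrA binary_addr_eq0.
Qed.

Lemma comega_odd (i : nat) : odd i ->
  comega F c i = (\sum_(b <- [:: 0; 1 + c; 1; c]%R) (cdelta F c 1%R b == i))%N.
Proof.
move=> oi; rewrite comega_sum (bigID [in [:: 0; 1 + c; 1; c]%R]) /=.
rewrite [X in (_ + X)%N]big1 => [|b /cdelta_generic[->|->]]; last 2 first.
- by case: i oi.
- by case: i oi => [|[|[]]].
rewrite addn0 big_uniq //= !inE !negb_or c1_neq1 c1_neqc.
by rewrite !(eq_sym 0) c1_neq0 oner_neq0 c0 eq_sym c1.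
Qed.

Let tc : bool := abs_trace n c == 0.
Let tV : bool := abs_trace n (1 / c) == 0.

(** The values 0 and [1 + c] always count; [c] and 1 move to [comega3] when the trace of [c],
    respectively [1 / c], vanishes. *)
Lemma comega1 : comega F c 1 = (4 - tc - tV)%N.
Proof.
rewrite comega_odd // !big_cons big_nil cdelta_at0 cdelta_at1c cdelta_at1 cdelta_atc.
by rewrite -/tc -/tV; case: tc tV => -[].
Qed.

Lemma comega3 : comega F c 3 = (tc + tV)%N.
Proof.
rewrite comega_odd // !big_cons big_nil cdelta_at0 cdelta_at1c cdelta_at1 cdelta_atc.
by rewrite -/tc -/tV; case: tc tV => -[].
Qed.

Lemma cdelta_le3 (a b : K) : (cdelta F c a b <= 3)%N.
Proof.
have [->|a0] := eqVneq a 0; first by rewrite cdelta_shift0.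
rewrite cdelta_scale //; have [|/cdelta_generic[->|->]//] := boolP (a * b \in [:: 0; 1 + c; 1; c]).
rewrite !inE => /or4P[]/eqP->; rewrite ?cdelta_at0 ?cdelta_at1c ?cdelta_at1 ?cdelta_atc //.
  by case: eqP.
by case: eqP.
Qed.

Lemma comega_total :
  (comega F c 0 + comega F c 1 + comega F c 2 + comega F c 3 = 2 ^ n)%N.
Proof.
rewrite -cardK -sum1_card !comega_sum -!big_split; apply: eq_bigr => b _ /=.
by move: (cdelta_le3 1 b); case: (cdelta _ _ _ _) => [|[|[|[]]]].
Qed.

(** Each [x] is a solution for exactly one [b]. *)
Lemma comega_weighted_total :
  (comega F c 1 + 2 * comega F c 2 + 3 * comega F c 3 = 2 ^ n)%N.
Proof.
rewrite -cardK -(cdelta_sum _ F c 1) !comega_sum !big_distrr -!big_split; apply: eq_bigr => b _ /=.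
by move: (cdelta_le3 1 b); case: (cdelta _ _ _ _) => [|[|[|[]]]].
Qed.

(** As [c != 1], the shift 0 enters the maximum; its count is always 1, whence [0 < u]. *)
Lemma cuniformity_le (u : nat) :
  (forall b : K, cdelta F c 1%R b <= u)%N -> (0 < u)%N -> (cuniformity F c <= u)%N.
Proof.
move=> hu u0; apply/bigmax_leqP => a _; apply/bigmax_leqP => b _.
by have [->|a0] := eqVneq a 0; rewrite ?cdelta_shift0 // cdelta_scale.
Qed.

Lemma cuniformity_ge (u : nat) : (0 < comega F c u)%N -> (u <= cuniformity F c)%N.
Proof.
case/card_gt0P => b; rewrite inE => /eqP <-.
by apply: cdelta_le_cuniformity; rewrite (negPf c1).
Qed.

End Inversion.

End BinaryField.

(** * The three trace cases *)

Theorem theorem7 (n : nat) (K : finFieldType) (c : K)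
    (hn : (0 < n)%N) (hK : #|K| = (2 ^ n)%N) (hc0 : c != 0) (hc1 : c != 1) :
  let F := @power_fun K (2 ^ n - 2)%N in
  [/\ abs_trace n c = 1 /\ abs_trace n (1 / c) = 1 ->
        (n <> 2%N -> APcN F c) /\
        has_cspectrum F c [:: (2 ^ (n - 1) - 2)%N; 4%N; (2 ^ (n - 1) - 2)%N],
      (abs_trace n c = 1 /\ abs_trace n (1 / c) = 0) \/
      (abs_trace n c = 0 /\ abs_trace n (1 / c) = 1) ->
        differentially_uniform F c 3%N /\
        has_cspectrum F c
          [:: (2 ^ (n - 1) - 1)%N; 3%N; (2 ^ (n - 1) - 3)%N; 1%N]
    & abs_trace n c = 0 /\ abs_trace n (1 / c) = 0 ->
        differentially_uniform F c 3%N /\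
        has_cspectrum F c
          [:: (2 ^ (n - 1))%N; 2%N; (2 ^ (n - 1) - 4)%N; 2%N]].
Proof.
move=> F.
have w1 := comega1 _ _ hn hK _ hc0 hc1; have w3 := comega3 _ _ hn hK _ hc0 hc1.
have S0 := comega_total _ _ hn hK _ hc0 hc1; have S1 := comega_weighted_total _ _ hn hK _ hc0 hc1.
have ge := cuniformity_ge n K c hc1; have le := cuniformity_le _ _ hn hK _ hc0 hc1.
have le3 : (cuniformity F c <= 3)%N by apply: le => // b; exact: (cdelta_le3 _ _ hn hK _ hc0 hc1).
rewrite -/F in w1 w3 S0 S1 ge le.
have p2 : (2 ^ n = 2 * 2 ^ (n - 1))%N by rewrite subn1 -expnS prednK.
have unif3 : (0 < comega F c 3)%N -> cuniformity F c = 3%N.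
  by move=> /ge ge3; apply/eqP; rewrite eqn_leq le3.
split=> H.
- have [Tc TV] := H; rewrite Tc TV oner_eq0 /= in w1 w3.
  have le2 : (cuniformity F c <= 2)%N.
    apply: le => // b; rewrite -ltnS ltn_neqAle (cdelta_le3 _ _ hn hK _ hc0 hc1) andbT.
    apply/eqP => e; have : b \in [set b : K | cdelta F c 1 b == 3%N] by rewrite inE e.
    by rewrite (cards0_eq w3) inE.
  (* The bound [le2] suffices here, so [n = 2], where the uniformity is 1, is covered. *)
  split; last by apply: has_cspectrumP => // -[|[|[|//]]] _ /=; lia.
  (* The value 2 is attained because [2 ^ (n - 1) - 2] is positive once [n >= 3]; [n = 1]
     contradicts [comega F c 1 = 4]. *)
  move=> n2; apply/eqP; rewrite eqn_leq le2; apply: ge.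
  have n1 : n <> 1%N by move=> n1; move: S0; rewrite w1 n1; lia.
  have : (2 ^ 2 <= 2 ^ (n - 1))%N by rewrite leq_exp2l //; lia.
  lia.
(* Both subcases agree, since [comega1] and [comega3] depend only on how many of the two traces
   vanish. *)
- have w : comega F c 1 = 3%N /\ comega F c 3 = 1%N.
    by move: w1 w3; case: H => -[-> ->]; rewrite eqxx oner_eq0.
  have u3 : cuniformity F c = 3%N by apply: unif3; lia.
  split=> //; apply: has_cspectrumP; first by rewrite u3.
  by case=> [|[|[|[|//]]]] _ /=; lia.
- have [Tc TV] := H; rewrite Tc TV eqxx /= in w1 w3.
  have u3 : cuniformity F c = 3%N by apply: unif3; lia.
  split=> //; apply: has_cspectrumP; first by rewrite u3.
  by case=> [|[|[|[|//]]]] _ /=; lia.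
Qed.
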